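(* Let $k$ be a field, let $(A,B,\varepsilon)$ be a commutative triple over $k$, and let $M$ be an $A$-symmetric $A$-bimodule. Then $$\mathrm{H}_1((A,B,\varepsilon);M)\cong M\otimes_A\Omega^1_{A|B},$$ and in particular $\mathrm{H}_1((A,B,\varepsilon);A)\cong\Omega^1_{A|B}$.
   Context: Fix a field $k$; $\otimes=\otimes_k$, and all $k$-algebras are unital. A triple $(A,B,\varepsilon)$ over $k$ consists of an associative $k$-algebra $A$, a commutative $k$-algebra $B$, and a morphism of $k$-algebras $\varepsilon:B\to A$ with $\varepsilon(B)\subseteq\mathcal{Z}(A)$ (the center of $A$). The triple is commutative if $A$ is commutative. An $A$-bimodule $M$ is $A$-symmetric if $ma=am$ for all $m\in M$, $a\in A$. $\Omega^1_{A|B}$ denotes the $A$-module of $B$-linear Kähler differentials of $A$, where $A$ is a $B$-algebra via $\varepsilon$. The secondary Hochschild homology $\mathrm{H}_\bullet((A,B,\varepsilon);M)$ is the homology of a chain complex with $C_n((A,B,\varepsilon);M)=M\otimes A^{\otimes n}\otimes B^{\otimes n(n-1)/2}$. In degrees relevant for $\mathrm{H}_1$ it reads $$M\otimes A^{\otimes 2}\otimes B\xrightarrow{\ \partial_2^\varepsilon\ }M\otimes A\xrightarrow{\ \partial_1^\varepsilon\ }M\to 0,$$ with $$\partial_1^\varepsilon(m\otimes a)=ma-am,\qquad \partial_2^\varepsilon\left(m\otimes\begin{pmatrix}a&\alpha\\1&b\end{pmatrix}\right)=ma\varepsilon(\alpha)\otimes b-m\otimes a\varepsilon(\alpha)b+b\varepsilon(\alpha)m\otimes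 a,$$ where the elementary tensor of $M\otimes A^{\otimes 2}\otimes B$ with components $m\in M$, $a,b\in A$, $\alpha\in B$ is written $m\otimes\begin{pmatrix}a&\alpha\\1&b\end{pmatrix}$. Thus $\mathrm{H}_1((A,B,\varepsilon);M)=\ker\partial_1^\varepsilon/\operatorname{im}\partial_2^\varepsilon$. *)

(* Defs.v *)
From HB Require Import structures.
From mathcomp Require Import all_boot all_algebra.
From mathcomp Require Import boolp classical_sets functions cardinality fsbigop.

Set Implicit Arguments.
Unset Strict Implicit.
Unset Printing Implicit Defensive.

Import GRing.Theory.

Local Open Scope ring_scope.
Local Open Scope quotient_scope.

Definition bundle_linear (R : pzRingType) (U V : lmodType R) (f : U -> V)
    (lin_f : linear f) : {linear U -> V} :=
  HB.pack f (GRing.isLinear.Build R U V *:%R f lin_f).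

Definition bilinear_map (R : pzRingType) (U V W : lmodType R)
    (f : U -> V -> W) : Prop :=
  (forall v, linear (f^~ v)) /\ (forall u, linear (f u)).

Definition lmod_isomorphic (R : pzRingType) (U V : lmodType R) : Prop :=
  exists f : {linear U -> V}, bijective f.

Section Span.
Variables (R : pzRingType) (V : lmodType R) (X : set V).

Inductive in_span : V -> Prop :=
| Span0 : in_span 0
| SpanGen a x v : X x -> in_span v -> in_span (a *: x + v).

Definition span : pred V := fun v => `[< in_span v >].

Fact span_submod : submod_closed span.
Proof.
split=> [|a u v]; first by rewrite unfold_in; apply/asboolP/Span0.
rewrite !unfold_in => /asboolP su /asboolP sv; apply/asboolP.
elim: su => [|b x w Xx _ IH]; first by rewrite scaler0 add0r.
by rewrite scalerDr scalerA -addrA; apply: SpanGen.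
Qed.

HB.instance Definition _ := GRing.isSubmodClosed.Build R V span span_submod.

Definition spanmod : submodClosed V := GRing.SubmodClosed.clone R V span _.

Lemma mem_span x : X x -> x \in span.
Proof.
move=> Xx; rewrite unfold_in; apply/asboolP.
by rewrite -[x]addr0 -[x]scale1r; apply: SpanGen => //; exact: Span0.
Qed.

End Span.

Record quotient_module (R : pzRingType) (V : lmodType R) (S : submodClosed V) :=
  Quotient {
    quot_mod : lmodType R;
    quot_pi : {linear V -> quot_mod};
    quot_repr : quot_mod -> V;
    quot_reprK : forall x, quot_pi (quot_repr x) = x;
    quot_piE : forall v, quot_pi v = 0 <-> v \in S }.

Arguments quot_pi {R V S} q.
Arguments quot_repr {R V S} q x.

Module QuotientConstruction.
Section Construction.
Variables (R : pzRingType) (V : lmodType R) (S : submodClosed V).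

Definition zpred : pred V := fun v => v \in S.

Fact zpred_zmod : zmod_closed zpred.
Proof.
split=> [|u v Su Sv]; rewrite unfold_in /zpred ?rpred0 //.
by rewrite -scaleN1r rpredD // rpredZ.
Qed.

HB.instance Definition _ := GRing.isZmodClosed.Build V zpred zpred_zmod.

Let zmod : zmodClosed V := GRing.ZmodClosed.clone V zpred _.

Definition Q : Type := ring_quotient.Quotient.quot zmod.

HB.instance Definition _ := GRing.Zmodule.on Q.

Definition pi (v : V) : Q := \pi_(ring_quotient.Quotient.quot zmod) v.
Definition rep (x : Q) : V := repr (x : ring_quotient.Quotient.quot zmod).

Lemma repK x : pi (rep x) = x. Proof. exact: reprK. Qed.

Lemma pi_eq u v : pi u = pi v <-> u - v \in S.
Proof.
have := ring_quotient.Quotient.idealrBE zmod u v.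
by rewrite unfold_in /zpred => ->; split=> /eqP.
Qed.

Lemma piD u v : pi (u + v) = pi u + pi v.
Proof. exact: (raddfD (\pi_(ring_quotient.Quotient.quot zmod))). Qed.

Definition scale (a : R) (x : Q) : Q := pi (a *: rep x).

Lemma piZ a v : pi (a *: v) = scale a (pi v).
Proof.
by apply/pi_eq; rewrite -scalerBr rpredZ //; apply/pi_eq; rewrite repK.
Qed.

Fact scaleA a b x : scale a (scale b x) = scale (a * b) x.
Proof. by rewrite -[x]repK -!piZ scalerA. Qed.
Fact scale1 : left_id 1 scale.
Proof. by move=> x; rewrite -[x]repK -!piZ scale1r. Qed.
Fact scaleDr : right_distributive scale +%R.
Proof.
by move=> a x y; rewrite -[x]repK -[y]repK -piD -!piZ scalerDr piD.
Qed.
Fact scaleDl x : {morph scale^~ x : a b / a + b}.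
Proof. by move=> a b; rewrite -[x]repK -!piZ scalerDl piD. Qed.

HB.instance Definition _ := GRing.Zmodule_isLmodule.Build R Q
  scaleA scale1 scaleDr scaleDl.

Fact pi_linear : linear pi.
Proof. by move=> a u v; rewrite piD piZ. Qed.

Fact pi0 v : bundle_linear pi_linear v = 0 <-> v \in S.
Proof.
by rewrite -[v in v \in S]subr0 -pi_eq -(linear0 (bundle_linear pi_linear)).
Qed.

(* Opaque on purpose: the fields of [quotient_module] determine it up to a
   unique isomorphism, and a transparent value makes conversion very slow. *)
Definition build : quotient_module S.
Proof.
exact (@Quotient R V S (GRing.Lmodule.clone R Q _)
  (bundle_linear pi_linear) rep repK pi0).
Qed.

End Construction.
End QuotientConstruction.

Definition quotient_of (R : pzRingType) (V : lmodType R)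
  (S : submodClosed V) : quotient_module S := QuotientConstruction.build S.

Section QuotientModule.
Variables (R : pzRingType) (V : lmodType R) (S : submodClosed V).

Definition quotmod : lmodType R := quot_mod (quotient_of S).
Definition qpi : {linear V -> quotmod} := quot_pi (quotient_of S).
Definition qrepr : quotmod -> V := quot_repr (quotient_of S).

Lemma qreprK x : qpi (qrepr x) = x. Proof. exact: quot_reprK. Qed.

Lemma qpi0 v : qpi v = 0 <-> v \in S. Proof. exact: quot_piE. Qed.

Lemma qpi_eq u v : qpi u = qpi v <-> u - v \in S.
Proof.
rewrite -qpi0 linearB; split=> [->|/eqP]; first exact: subrr.
by rewrite subr_eq0 => /eqP.
Qed.

Lemma quotmod_ext (W : lmodType R) (g h : {linear quotmod -> W}) :
  (forall v, g (qpi v) = h (qpi v)) -> g =1 h.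
Proof. by move=> gh x; rewrite -[x]qreprK. Qed.

Section Lift.
Variables (W : lmodType R) (f : {linear V -> W}).
Hypothesis f0 : forall v, v \in S -> f v = 0.

Let lift_fun (x : quotmod) : W := f (qrepr x).

Fact qlift_fun_pi v : lift_fun (qpi v) = f v.
Proof.
by apply/eqP; rewrite -subr_eq0 -linearB; apply/eqP/f0/qpi_eq; rewrite qreprK.
Qed.

Fact qlift_linear : linear lift_fun.
Proof.
move=> a x y; rewrite -[x]qreprK -[y]qreprK -linearP !qlift_fun_pi.
exact: linearP.
Qed.

Definition qlift : {linear quotmod -> W} := bundle_linear qlift_linear.

Lemma qliftE v : qlift (qpi v) = f v. Proof. exact: qlift_fun_pi. Qed.

End Lift.

End QuotientModule.

Arguments qpi : simpl never.
Arguments qlift : simpl never.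

Section FreeModule.
Variables (R : pzRingType) (K : choiceType).

Definition fin_supp : pred (K -> R^o) :=
  fun f => `[< finite_set [set k | f k != 0] >].

Fact fin_supp_submod : submod_closed fin_supp.
Proof.
split=> [|a f g]; rewrite !unfold_in.
  apply/asboolP; apply: (sub_finite_set (B := set0)) => // k /=.
  by move/eqP; apply.
move=> /asboolP ff /asboolP fg; apply/asboolP.
apply: (sub_finite_set (B := [set k | f k != 0] `|` [set k | g k != 0])).
  move=> k /=; rewrite [X in X != 0](_ : _ = a * f k + g k) //.
  apply: contraPP => /not_orP[/negP/negPn/eqP-> /negP/negPn/eqP->].
  by rewrite mulr0 addr0 eqxx.
by rewrite finite_setU.
Qed.

HB.instance Definition _ := GRing.isSubmodClosed.Build R (K -> R^o) fin_supp
  fin_supp_submod.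

Record free_module := FreeModule {
  fm_coef :> K -> R^o;
  fm_supp : fin_supp fm_coef }.

HB.instance Definition _ := [isSub for fm_coef].
HB.instance Definition _ := [Choice of free_module by <:].
HB.instance Definition _ := [SubChoice_isSubLmodule of free_module by <:].


Fact basis_supp k : fin_supp (fun i => (i == k)%:R : R^o).
Proof.
apply/asboolP/(sub_finite_set (B := [set k])) => // i /=.
by case: (i =P k) => // _; rewrite eqxx.
Qed.

Definition basis (k : K) : free_module := FreeModule (basis_supp k).

Section FreeLift.
Variables (V : lmodType R) (g : K -> V).

Let lift_fun (f : free_module) : V :=
  \sum_(k \in [set k | f k != 0]) (f k : R) *: g k.

Fact free_lift_seq (r : seq K) (f : free_module) :
    uniq r -> (forall k, f k != 0 -> k \in r) ->
  lift_fun f = \sum_(k <- r) (f k : R) *: g k.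
Proof.
move=> ur fr; apply: fsbig_fwiden => //.
by move=> k [_ /= /negP/negPn/eqP->]; rewrite scale0r.
Qed.

Fact free_supp_seq (f : free_module) :
  exists2 r : seq K, uniq r & forall k, f k != 0 -> k \in r.
Proof.
have /asboolP fin := fm_supp f.
exists (finmap.enum_fset (fset_set [set k | f k != 0])).
  exact: finmap.fset_uniq.
by move=> k fk; exact: etrans (in_fset_set fin k) (mem_set fk).
Qed.

Fact free_lift_linear : linear lift_fun.
Proof.
move=> a x y; have [rx _ xP] := free_supp_seq x; have [ry _ yP] := free_supp_seq y.
have ur := undup_uniq (rx ++ ry).
rewrite !(free_lift_seq ur).
- by rewrite scaler_sumr -big_split; apply: eq_bigr => k _; rewrite scalerDl scalerA.
- by move=> k /yP; rewrite mem_undup mem_cat orbC => ->.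
- by move=> k /xP; rewrite mem_undup mem_cat => ->.
- move=> k; rewrite mem_undup mem_cat; apply: contraNT; rewrite negb_or.
  case/andP=> /(contra (@xP k))/negPn/eqP xk /(contra (@yP k))/negPn/eqP yk.
  by rewrite [X in X == 0](_ : _ = a * x k + y k) // xk yk mulr0 addr0.
Qed.

Definition free_lift : {linear free_module -> V} :=
  bundle_linear free_lift_linear.

Lemma free_liftE k : free_lift (basis k) = g k.
Proof.
rewrite /= (@free_lift_seq [:: k]) //.
  by rewrite big_seq1 /= eqxx scale1r.
by move=> i /=; rewrite inE; case: (i =P k) => // _; rewrite eqxx.
Qed.

End FreeLift.

Lemma free_module_ext (V : lmodType R) (g h : {linear free_module -> V}) :
  (forall k, g (basis k) = h (basis k)) -> g =1 h.
Proof.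
move=> gh f; have [r ur rP] := free_supp_seq f.
suff -> : f = \sum_(k <- r) (f k : R) *: basis k.
  by rewrite !linear_sum; apply: eq_bigr => k _; rewrite !linearZ /= gh.
apply/val_inj/funext => i; rewrite linear_sum /= fct_sumE.
have [ir|] := boolP (i \in r).
  rewrite (bigD1_seq i) //= big1 => [|k /negPf ki].
    by rewrite addr0 scalrfctE eqxx; exact/esym/mulr1.
  by rewrite scalrfctE eq_sym ki; exact: mulr0.
move=> iNr; have /negPn/eqP -> := contra (@rP i) iNr.
rewrite big_seq big1 // => k kr; rewrite scalrfctE.
case: (i =P k) => [ik|_]; last exact: mulr0.
by rewrite ik kr in iNr.
Qed.

End FreeModule.

Arguments free_lift : simpl never.
Arguments free_module : clear implicits.
Arguments basis R {K} k : simpl never.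

Section Tensor.
Variables (R : comPzRingType) (M N : lmodType R).

Local Notation "<< m , n >>" := (basis R ((m, n) : M * N)).

Definition tensor_rel : set (free_module R (M * N)%type) := fun x =>
  (exists a m m' n, x = << a *: m + m', n >> - (a *: << m, n >> + << m', n >>))
  \/
  (exists a m n n', x = << m, a *: n + n' >> - (a *: << m, n >> + << m, n' >>)).

Definition tensor : lmodType R := quotmod (spanmod tensor_rel).

Definition tens (m : M) (n : N) : tensor := qpi (spanmod tensor_rel) << m, n >>.

Lemma tens_bilinear : bilinear_map tens.
Proof.
split=> [n a m m'|m a n n']; rewrite /= /tens -linearP;
  apply/qpi_eq/mem_span.
  by left; exists a, m, m', n.
by right; exists a, m, n, n'.
Qed.

Lemma tensor_ext (W : lmodType R) (g h : {linear tensor -> W}) :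
  (forall m n, g (tens m n) = h (tens m n)) -> g =1 h.
Proof.
move=> gh; apply: quotmod_ext => v.
by apply: (free_module_ext (g := g \o qpi (spanmod _)) (h := h \o qpi (spanmod _))) => -[m n]; exact: gh.
Qed.

Section Lift.
Variables (W : lmodType R) (f : M -> N -> W).
Hypothesis bil_f : bilinear_map f.

Let lift0 := free_lift (fun p : M * N => f p.1 p.2).

Fact tensor_lift_rel v : v \in span tensor_rel -> lift0 v = 0.
Proof.
rewrite unfold_in => /asboolP; elim=> [|a x w xP _ IH]; first exact: linear0.
rewrite linearP IH addr0; case: xP => -[b [m [m' [n ->]]]];
  rewrite linearB linearP !free_liftE /= ?(bil_f.1 n b) ?(bil_f.2 m b) subrr;
  exact: scaler0.
Qed.

Definition tensor_lift : {linear tensor -> W} := qlift tensor_lift_rel.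

Lemma tensor_liftE m n : tensor_lift (tens m n) = f m n.
Proof. by rewrite /tensor_lift /tens qliftE free_liftE. Qed.

End Lift.

End Tensor.

Arguments tens : simpl never.
Arguments tensor_lift : simpl never.

Section TensorMaps.
Variables (R : comPzRingType).

Definition tensl (M N : lmodType R) (n : N) : {linear M -> tensor M N} :=
  bundle_linear ((tens_bilinear M N).1 n).

Fact tensor_mapl_bilinear (M M' N : lmodType R) (h : {linear M -> M'}) :
  bilinear_map (fun (m : M) (n : N) => tens (h m) n).
Proof.
by split=> [n a m m'|m a n n']; rewrite ?linearP ?(tens_bilinear _ _).1
  ?(tens_bilinear _ _).2.
Qed.

Definition tensor_mapl (M M' N : lmodType R) (h : {linear M -> M'}) :
    {linear tensor M N -> tensor M' N} :=
  tensor_lift (tensor_mapl_bilinear N h).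

Lemma tensor_maplE (M M' N : lmodType R) (h : {linear M -> M'}) m (n : N) :
  tensor_mapl N h (tens m n) = tens (h m) n.
Proof. exact: tensor_liftE. Qed.

Variables (M N P Q W : lmodType R).

Definition tens4 (m : M) (n : N) (p : P) (q : Q) :
    tensor (tensor (tensor M N) P) Q := tens (tens (tens m n) p) q.

Lemma tensor_ext4 (g h : {linear tensor (tensor (tensor M N) P) Q -> W}) :
  (forall m n p q, g (tens4 m n p q) = h (tens4 m n p q)) -> g =1 h.
Proof.
move=> gh; apply: tensor_ext => z q.
apply: (tensor_ext (g := g \o tensl _ q) (h := h \o tensl _ q)) => y p.
apply: (tensor_ext (g := g \o tensl _ q \o tensl _ p)
                   (h := h \o tensl _ q \o tensl _ p)) => m n.
exact: gh.
Qed.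

Variable f : M -> N -> P -> Q -> W.

Definition multilinear4 : Prop :=
  [/\ forall n p q, linear (fun m => f m n p q),
      forall m p q, linear (fun n => f m n p q),
      forall m n q, linear (fun p => f m n p q)
    & forall m n p, linear (fun q => f m n p q)].

Hypothesis lin_f : multilinear4.

Fact lift4_bilinear2 p q : bilinear_map (fun m n => f m n p q).
Proof. by case: lin_f => l1 l2 _ _; split=> [n|m]; [exact: l1|exact: l2]. Qed.

Let lift2 p q : {linear tensor M N -> W} := tensor_lift (lift4_bilinear2 p q).

Fact comb_linear (V : lmodType R) a (g h : {linear V -> W}) :
  linear (fun x => a *: g x + h x).
Proof.
move=> b x y; rewrite (linearP g) (linearP h) !scalerDr !scalerA [a * b]mulrC.
exact: addrACA.
Qed.

Fact lift4_bilinear3 q : bilinear_map (fun x p => lift2 p q x).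
Proof.
split=> [p a x y|x a p p']; first exact: linearP.
apply: (tensor_ext (g := lift2 (a *: p + p') q)
  (h := bundle_linear (comb_linear a (lift2 p q) (lift2 p' q)))) => m n.
rewrite [RHS]/(a *: lift2 p q (tens m n) + lift2 p' q (tens m n)).
by rewrite /lift2 !tensor_liftE; have [_ _ l3 _] := lin_f; exact: l3.
Qed.

Let lift3 q : {linear tensor (tensor M N) P -> W} :=
  tensor_lift (lift4_bilinear3 q).

Fact lift4_bilinear4 : bilinear_map (fun x q => lift3 q x).
Proof.
split=> [q a x y|x a q q']; first exact: linearP.
apply: (tensor_ext (g := lift3 (a *: q + q'))
  (h := bundle_linear (comb_linear a (lift3 q) (lift3 q')))) => y p.
rewrite [RHS]/(a *: lift3 q (tens y p) + lift3 q' (tens y p)).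
rewrite /lift3 !tensor_liftE.
apply: (tensor_ext (g := lift2 p (a *: q + q'))
  (h := bundle_linear (comb_linear a (lift2 p q) (lift2 p q')))) => m n.
rewrite [RHS]/(a *: lift2 p q (tens m n) + lift2 p q' (tens m n)).
by rewrite /lift2 !tensor_liftE; have [_ _ _ l4] := lin_f; exact: l4.
Qed.

Definition tensor_lift4 : {linear tensor (tensor (tensor M N) P) Q -> W} :=
  tensor_lift lift4_bilinear4.

Lemma tensor_lift4E m n p q : tensor_lift4 (tens4 m n p q) = f m n p q.
Proof. by rewrite /tensor_lift4 tensor_liftE /lift3 tensor_liftE tensor_liftE. Qed.

End TensorMaps.

Arguments tensor_mapl : simpl never.
Arguments tensor_lift4 : simpl never.

Section Kaehler.
Variables (B A : comPzRingType) (eps : {rmorphism B -> A}).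

Definition kaehler_rel : set (free_module A A) := fun x =>
  [\/ exists a b, x = basis A (a + b) - (basis A a + basis A b),
      exists (beta : B) a, x = basis A (eps beta * a) - eps beta *: basis A a
    | exists a b, x = basis A (a * b) - (a *: basis A b + b *: basis A a)].

Definition kaehler : lmodType A := quotmod (spanmod kaehler_rel).

Definition kaehler_d (a : A) : kaehler := qpi (spanmod kaehler_rel) (basis A a).

End Kaehler.

(* [homology f g] is ker g / (im f \cap ker g), i.e. ker g / im f when
   g \o f = 0. *)

Section Homology.
Variables (R : pzRingType) (U V W : lmodType R).
Variables (f : {linear U -> V}) (g : {linear V -> W}).

Definition ker_pred : pred V := fun v => g v == 0.

Fact ker_submod : submod_closed ker_pred.
Proof.
split=> [|a u v]; first by rewrite unfold_in /ker_pred linear0.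
by rewrite !unfold_in /ker_pred linearP => /eqP-> /eqP->; rewrite scaler0 addr0.
Qed.

HB.instance Definition _ := GRing.isSubmodClosed.Build R V ker_pred ker_submod.

Record kernel := Kernel { ker_val :> V; ker_valP : ker_pred ker_val }.

HB.instance Definition _ := [isSub for ker_val].
HB.instance Definition _ := [Choice of kernel by <:].
HB.instance Definition _ := [SubChoice_isSubLmodule of kernel by <:].

Definition boundary : pred kernel := fun z => `[< exists u, f u = z :> V >].

Fact boundary_submod : submod_closed boundary.
Proof.
split=> [|a y z]; rewrite !unfold_in.
  by apply/asboolP; exists 0; rewrite linear0.
move=> /asboolP[u uy] /asboolP[v vz]; apply/asboolP; exists (a *: u + v).
by rewrite linearP uy vz.
Qed.

HB.instance Definition _ := GRing.isSubmodClosed.Build R kernel boundary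
  boundary_submod.

Definition boundaries : submodClosed kernel :=
  GRing.SubmodClosed.clone R kernel boundary _.

Definition homology : lmodType R := quotmod boundaries.

Definition hclass (z : kernel) : homology := qpi boundaries z.

End Homology.

(* MathComp's [algType] and [comAlgType] exclude the zero algebra; here an
   algebra is a possibly zero ring with a structure map landing in its center. *)
Record algebra (k : fieldType) := Algebra {
  alg_ring :> pzRingType;
  alg_map : {rmorphism k -> alg_ring};
  alg_mapC : forall c x, alg_map c * x = x * alg_map c }.

Record comAlgebra (k : fieldType) := ComAlgebra {
  calg_ring :> comPzRingType;
  calg_map : {rmorphism k -> calg_ring} }.

Coercion algebra_of_com (k : fieldType) (A : comAlgebra k) : algebra k :=
  @Algebra k A (calg_map A) (fun c x => mulrC (calg_map A c) x).

Definition comAlgebra_of (k : fieldType) (A : comAlgType k) : comAlgebra k :=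
  ComAlgebra (GRing.in_alg A : {rmorphism k -> A}).

(* The k-vector space underlying an algebra. *)
Definition vsp (k : fieldType) (A : algebra k) : Type := A.

Section VectorSpace.
Variables (k : fieldType) (A : algebra k).

HB.instance Definition _ := GRing.Zmodule.on (vsp A).

Let scale (c : k) (x : vsp A) : vsp A := alg_map A c * (x : A).

Fact vsp_scaleA c d x : scale c (scale d x) = scale (c * d) x.
Proof. by rewrite /scale mulrA -rmorphM. Qed.
Fact vsp_scale1 : left_id 1 scale.
Proof. by move=> x; rewrite /scale rmorph1 mul1r. Qed.
Fact vsp_scaleDr : right_distributive scale +%R.
Proof. by move=> c x y; exact: mulrDr. Qed.
Fact vsp_scaleDl x : {morph scale^~ x : c d / c + d}.
Proof. by move=> c d; rewrite /scale rmorphD; exact: mulrDl. Qed.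

HB.instance Definition _ := GRing.Zmodule_isLmodule.Build k (vsp A)
  vsp_scaleA vsp_scale1 vsp_scaleDr vsp_scaleDl.

Lemma vsp_mul_bilinear : bilinear_map (fun x y : vsp A => (x : A) * y : vsp A).
Proof.
split=> [y c x x'|x c y y']; first by rewrite [LHS]mulrDl -mulrA.
by rewrite [LHS]mulrDr mulrA -alg_mapC -mulrA.
Qed.

End VectorSpace.

(* The actions are k-bilinear and unital, so k acts on M through A on either
   side. *)
Record bimodule (k : fieldType) (A : algebra k) := Bimodule {
  bim_vsp :> lmodType k;
  lact : vsp A -> bim_vsp -> bim_vsp;
  ract : bim_vsp -> vsp A -> bim_vsp;
  lact_bilinear : bilinear_map lact;
  ract_bilinear : bilinear_map ract;
  lact1 : forall m, lact (1 : A) m = m;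
  ract1 : forall m, ract m (1 : A) = m;
  lactM : forall (a b : A) m, lact (a * b) m = lact a (lact b m);
  ractM : forall (a b : A) m, ract m (a * b) = ract (ract m a) b;
  lractA : forall (a b : A) m, ract (lact a m) b = lact a (ract m b) }.

Definition bim_symmetric (k : fieldType) (A : algebra k) (M : bimodule A) :
  Prop := forall (m : M) (a : A), ract m a = lact a m.

Definition regular_bimodule (k : fieldType) (A : algebra k) : bimodule A :=
  @Bimodule k A (vsp A) _ _ (vsp_mul_bilinear A) (vsp_mul_bilinear A)
    (@mul1r A) (@mulr1 A) (fun a b m => esym (mulrA a b m))
    (fun a b m => mulrA m a b) (fun a b m => esym (mulrA a m b)).

Lemma regular_symmetric (k : fieldType) (A : comAlgebra k) :
  bim_symmetric (regular_bimodule A).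
Proof. by move=> m a; exact: (@mulrC A). Qed.

Arguments regular_symmetric {k} A m a.

Record triple (k : fieldType) (A : algebra k) (B : comAlgebra k) := Triple {
  triple_map :> {rmorphism B -> A};
  triple_mapk : forall c : k, triple_map (calg_map B c) = alg_map A c;
  triple_mapC : forall (beta : B) (a : A),
    triple_map beta * a = a * triple_map beta }.

Section SecondaryHochschild.
Variables (k : fieldType) (A : algebra k) (B : comAlgebra k).
Variables (eps : triple A B) (M : bimodule A).

Definition chain1 : lmodType k := tensor M (vsp A).
Definition chain2 : lmodType k :=
  tensor (tensor (tensor M (vsp A)) (vsp A)) (vsp B).

Fact d1_bilinear :
  bilinear_map (fun (m : M) (a : vsp A) => ract m a - lact a m).
Proof.
split=> [a c m m'|m c a a'].
  by rewrite (ract_bilinear M).1 (lact_bilinear M).2 scalerBr opprD addrACA.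
by rewrite (ract_bilinear M).2 (lact_bilinear M).1 scalerBr opprD addrACA.
Qed.

Definition d1 : {linear chain1 -> M} := tensor_lift d1_bilinear.

Definition d2_elem (m : M) (a b : vsp A) (alpha : vsp B) : chain1 :=
  tens (ract m ((a : A) * eps alpha)) b
  - tens m ((a : A) * eps alpha * b : vsp A)
  + tens (lact ((b : A) * eps alpha) m) a.

Fact comb3 (R : pzRingType) (V : lmodType R) (c : R) (x x' y y' z z' : V) :
  c *: x + x' - (c *: y + y') + (c *: z + z')
  = c *: (x - y + z) + (x' - y' + z').
Proof.
by rewrite !scalerDr scalerN opprD [X in X + _ = _]addrACA; exact: addrACA.
Qed.

Fact d2_multilinear : multilinear4 d2_elem.
Proof.
have [l1 l2] := lact_bilinear M; have [r1 r2] := ract_bilinear M.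
have [t1 t2] := tens_bilinear M (vsp A).
have [v1 v2] := vsp_mul_bilinear A.
have epsl : linear (fun alpha : vsp B => eps alpha : vsp A).
  by move=> c x y; rewrite rmorphD rmorphM triple_mapk.
have comb := @comb3 k (tensor M (vsp A)).
split.
- move=> a b al c m m'; rewrite /d2_elem -comb (r1 _ c) (t1 _ c) (t1 _ c).
  by rewrite (l2 _ c) (t1 _ c).
- move=> m b al c a a'; rewrite /d2_elem -comb.
  by rewrite (v1 _ c) (r2 _ c) (t1 _ c) (v1 _ c) (t2 _ c) (t2 _ c).
- move=> m a al c b b'; rewrite /d2_elem -comb.
  by rewrite (v2 _ c) (v1 _ c) (l1 _ c) !(t1 _ c) !(t2 _ c).
move=> m a b c al al'; rewrite /d2_elem -comb (epsl c) !(v2 _ c) (v1 _ c).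
by rewrite (r2 _ c) (l1 _ c) !(t1 _ c) (t2 _ c).
Qed.

Definition d2 : {linear chain2 -> chain1} := tensor_lift4 d2_multilinear.

Lemma d2E m a b alpha : d2 (tens4 m a b alpha) = d2_elem m a b alpha.
Proof. exact: tensor_lift4E. Qed.

(* The hypothesis is the B-symmetry of M that makes the sequence a complex;
   it holds when M is A-symmetric. *)
Lemma d1_d2 (symB : forall (m : M) (beta : B), ract m (eps beta) = lact (eps beta) m) :
  forall u, d1 (d2 u) = 0.
Proof.
move=> u.
apply: (tensor_ext4 (g := d1 \o d2) (h := \0 )) => m a b al.
have e1 : ract m ((a : A) * eps al * b) = ract (ract m ((a : A) * eps al)) b.
  exact: ractM.
have e2 : lact ((a : A) * eps al * b) m = lact a (lact ((b : A) * eps al) m).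
  by rewrite -mulrA triple_mapC; exact: lactM.
have e3 : ract (lact ((b : A) * eps al) m) a = lact b (ract m ((a : A) * eps al)).
  rewrite (@lactM _ _ _ b) -symB lractA -triple_mapC; congr (lact b _).
  exact/esym/ractM.
transitivity (d1 (d2_elem m a b al)); first by rewrite -d2E.
rewrite [RHS]/(0 : M) /d2_elem (linearD d1) (linearB d1) /d1 !tensor_liftE e1 e2 e3.
by rewrite opprB [X in X + _]addrC [X in X + _]addrA subrK addrA subrK subrr.
Qed.

Definition H1 : lmodType k := homology d2 d1.

End SecondaryHochschild.

Definition left_action_type (k : fieldType) (A : algebra k) (M : bimodule A) : Type :=
  M.

Section LeftModule.
Variables (k : fieldType) (A : algebra k) (M : bimodule A).

HB.instance Definition _ := GRing.Zmodule.on (left_action_type M).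

Let scale (a : A) (m : left_action_type M) : left_action_type M := lact a (m : M).

Fact left_module_scaleA a b m : scale a (scale b m) = scale (a * b) m.
Proof. exact/esym/lactM. Qed.
Fact left_module_scale1 : left_id 1 scale.
Proof. by move=> m; exact: lact1. Qed.
Fact left_module_scaleDr : right_distributive scale +%R.
Proof.
move=> a m m'; have := (lact_bilinear M).2 a 1 m m'.
by rewrite !scale1r.
Qed.
Fact left_module_scaleDl m : {morph scale^~ m : a b / a + b}.
Proof.
move=> a b; have := (lact_bilinear M).1 m 1 a b.
by rewrite !scale1r.
Qed.

HB.instance Definition _ := GRing.Zmodule_isLmodule.Build A
  (left_action_type M)
  left_module_scaleA left_module_scale1 left_module_scaleDr left_module_scaleDl.

Definition left_module : lmodType A :=
  GRing.Lmodule.clone A (left_action_type M) _.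

Lemma left_moduleZ (a : A) (m : left_module) : a *: m = lact a (m : M).
Proof. by []. Qed.

End LeftModule.

(* For commutative A and symmetric M, the A-module structure on H1 induced by
   the action of A on the factor M of the chains: a [z] = [a z]. *)
Section H1Module.
Variables (k : fieldType) (A B : comAlgebra k) (eps : triple A B).
Variables (M : bimodule A).
Hypothesis symM : bim_symmetric M.

Local Notation C1 := (chain1 M).
Local Notation Z1 := (kernel (d1 M)).

Definition lactl (a : vsp A) : {linear M -> M} :=
  bundle_linear ((lact_bilinear M).2 a).

Definition chain1_act (a : vsp A) : {linear C1 -> C1} :=
  tensor_mapl (vsp A) (lactl a).

Lemma chain1_actE (a : vsp A) (m : M) (x : vsp A) :
  chain1_act a (tens m x) = tens (lact a m) x.
Proof. exact: tensor_maplE. Qed.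

Definition chain2_act (a : vsp A) : {linear chain2 B M -> chain2 B M} :=
  tensor_mapl (vsp B) (tensor_mapl (vsp A) (chain1_act a)).

Lemma d1_symmetric (x : C1) : d1 M x = 0.
Proof.
apply: (tensor_ext (g := d1 M) (h := \0)) => m a.
by rewrite /d1 tensor_liftE symM subrr.
Qed.

Lemma d2_act a u : d2 eps M (chain2_act a u) = chain1_act a (d2 eps M u).
Proof.
apply: (tensor_ext4 (g := d2 eps M \o chain2_act a)
                    (h := chain1_act a \o d2 eps M)) => m x y al.
have act4 : chain2_act a (tens4 m x y al) = tens4 (lact a m) x y al.
  by rewrite /chain2_act /chain1_act /tens4 !tensor_maplE.
apply: etrans (congr1 (d2 eps M) act4) _; rewrite d2E.
apply: etrans _ (congr1 (chain1_act a) (esym (d2E eps m x y al))).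
have f1 : ract (lact a m) ((x : A) * eps al) = lactl a (ract m ((x : A) * eps al)).
  exact: lractA.
pose p : vsp A := (y : A) * eps al.
have f2 : lact p (lact a m) = lactl a (lact p m).
  transitivity (lact ((p : A) * a : vsp A) m); first exact/esym/lactM.
  by rewrite mulrC; exact: lactM.
by rewrite /d2_elem (linearD (chain1_act a)) (linearB (chain1_act a))
  /chain1_act !tensor_maplE f1 f2.
Qed.

Definition cycle_act (a : vsp A) (z : Z1) : Z1 :=
  Kernel (introT eqP (d1_symmetric (chain1_act a (ker_val z)))).

Fact H1_act_linear (a : vsp A) : linear (fun z => hclass (d2 eps M) (cycle_act a z)).
Proof.
move=> c x y; rewrite -linearP; congr (qpi _ _); apply/val_inj.
by rewrite [RHS]linearP; exact: (linearP (chain1_act a)).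
Qed.

Fact H1_act_boundary (a : vsp A) z : z \in boundaries (d2 eps M) (d1 M) ->
  bundle_linear (H1_act_linear a) z = 0.
Proof.
rewrite unfold_in => /asboolP[u uz]; apply/qpi0; rewrite unfold_in.
by apply/asboolP; exists (chain2_act a u); rewrite d2_act uz.
Qed.

Definition H1_act (a : vsp A) : {linear H1 eps M -> H1 eps M} :=
  qlift (@H1_act_boundary a).

Lemma H1_actE a z : H1_act a (hclass (d2 eps M) z) = hclass (d2 eps M) (cycle_act a z).
Proof. exact: qliftE. Qed.

Lemma H1_act_alg_map (c : k) h : H1_act (alg_map A c : A) h = c *: h.
Proof.
rewrite -[h]qreprK; apply: etrans (H1_actE _ _) _; rewrite -linearZ.
congr (qpi _ _); apply/val_inj; rewrite [RHS]linearZ.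
pose e : vsp A := alg_map A c.
have linc : linear (fun x : C1 => c *: x).
  by move=> d x y; rewrite scalerDr !scalerA mulrC.
apply: (tensor_ext (g := chain1_act e) (h := bundle_linear linc)) => m x.
rewrite chain1_actE.
have -> : lact e m = c *: m.
  have -> : e = c *: ((1 : A) : vsp A) by exact/esym/mulr1.
  by rewrite -[in RHS](lact1 m);
    exact: (linearZ_LR (bundle_linear ((lact_bilinear M).1 m))).
exact: (linearZ_LR (tensl M x)).
Qed.

Lemma H1_ind (P : H1 eps M -> Prop) :
  (forall z, P (hclass (d2 eps M) z)) -> forall h, P h.
Proof. by move=> Pz h; rewrite -[h]qreprK; exact: Pz. Qed.

Definition H1_module_type (_ : bim_symmetric M) : Type := H1 eps M.

Local Notation H1A := (H1_module_type symM).

HB.instance Definition _ := GRing.Zmodule.on H1A.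

Let scale (a : A) (h : H1A) : H1A := H1_act a h.

Fact H1_scaleA a b h : scale a (scale b h) = scale (a * b) h.
Proof.
elim/H1_ind: h => z; rewrite /scale !H1_actE; congr (hclass _ _); apply/val_inj.
pose p : vsp A := a * b.
apply: (tensor_ext (g := chain1_act a \o chain1_act b)
                   (h := chain1_act p)) => m x.
apply: etrans (congr1 (chain1_act a) (chain1_actE b m x)) _.
rewrite !chain1_actE; congr (tens _ x); exact/esym/lactM.
Qed.

Fact H1_scale1 : left_id 1 scale.
Proof.
elim/H1_ind => z; rewrite /scale H1_actE; congr (hclass _ _); apply/val_inj.
pose e : vsp A := (1 : A).
apply: (tensor_ext (g := chain1_act e) (h := idfun)) => m x.
by rewrite chain1_actE; congr (tens _ x); exact: lact1.
Qed.

Fact H1_scaleDr : right_distributive scale +%R.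
Proof. by move=> a x y; exact: linearD. Qed.

Fact H1_scaleDl h : {morph scale^~ h : a b / a + b}.
Proof.
move=> a b; elim/H1_ind: h => z; rewrite /scale !H1_actE -linearD.
congr (qpi _ _); apply/val_inj; rewrite [RHS]linearD.
apply: (tensor_ext (g := chain1_act (a + b : vsp A))
                   (h := chain1_act a \+ chain1_act b)) => m x.
rewrite chain1_actE.
apply: etrans _ (congr2 +%R (esym (chain1_actE a m x))
                            (esym (chain1_actE b m x))).
have lin : lactl (a + b : vsp A) m = lactl a m + lactl b m.
  by have := (lact_bilinear M).1 m 1 a b; rewrite !scale1r.
rewrite -[lact _ _]/(lactl (a + b : vsp A) m) lin.
exact: (linearD (tensl M x)).
Qed.

HB.instance Definition _ := GRing.Zmodule_isLmodule.Build A H1A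
  H1_scaleA H1_scale1 H1_scaleDr H1_scaleDl.

Definition H1_module : lmodType A := GRing.Lmodule.clone A H1A _.

Lemma H1_moduleZ (a : A) (h : H1_module) : a *: h = H1_act a (h : H1 eps M).
Proof. by []. Qed.

End H1Module.

(* Main.v *)
(** The isomorphism sends the class of [m (x) a] to [m (x) da].  It kills
    boundaries because [d] is a [B]-linear derivation.  Conversely, the
    boundary of [m, a, b, alpha] reads
    [[m (x) a eps(alpha) b] = [m a eps(alpha) (x) b] + [b eps(alpha) m (x) a]]
    in homology; with [alpha = 1] this is the Leibniz rule, which gives
    [[m (x) 1] = 0], and then with [a = 1] it is [B]-linearity.  Hence
    [m (x) da |-> [m (x) a]] is well defined and inverse to the first map. *)

Require Import Defs.
From HB Require Import structures.
From mathcomp Require Import all_boot all_algebra.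
From mathcomp Require Import boolp classical_sets.

Set Implicit Arguments.
Unset Strict Implicit.
Unset Printing Implicit Defensive.

Import GRing.Theory.

Local Open Scope ring_scope.

(** * Linear algebra: isomorphisms, induction on tensors, restriction of scalars *)

Lemma cancel_lmod_isomorphic (R : pzRingType) (U V : lmodType R)
    (f : {linear U -> V}) (g : {linear V -> U}) :
  cancel f g -> cancel g f -> lmod_isomorphic U V.
Proof. by move=> fK gK; exists f, g. Qed.

Lemma lmod_isomorphic_trans (R : pzRingType) (U V W : lmodType R) :
  lmod_isomorphic U V -> lmod_isomorphic V W -> lmod_isomorphic U W.
Proof. by move=> [f bf] [g bg]; exists (g \o f); exact: bij_comp. Qed.

Lemma linear_additive (R : pzRingType) (U V : lmodType R) (f : U -> V) :
  linear f -> forall u v, f (u + v) = f u + f v.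
Proof. by move=> lf u v; have := lf 1 u v; rewrite !scale1r. Qed.

Lemma linear_scalable (R : pzRingType) (U V : lmodType R) (f : U -> V) :
  linear f -> forall a u, f (a *: u) = a *: f u.
Proof. by move=> lf a u; exact: (linearZ_LR (bundle_linear lf)). Qed.

(** Elementary tensors span: the projection modulo their span agrees with zero on all of them, hence
    is zero by [tensor_ext]. A scalar is absorbed into the left factor, so closure under sums is
    enough. *)
Lemma tensor_ind (R : comPzRingType) (M N : lmodType R)
    (P : tensor M N -> Prop) :
  P 0 -> (forall x y, P x -> P y -> P (x + y)) ->
  (forall m n, P (tens m n)) -> forall x, P x.
Proof.
move=> P0 PD Pt x.
pose S : set (tensor M N) := fun y => exists m n, y = tens m n.
have : x \in spanmod S.
  apply/qpi0.
  apply: (tensor_ext (g := qpi (spanmod S)) (h := \0)) => m n.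
  by apply/qpi0/mem_span; exists m, n.
rewrite unfold_in => /asboolP; elim=> [//|a y z [m [n ->]] _ Pz].
apply: PD => //; rewrite -(linear_scalable ((tens_bilinear M N).1 n)).
exact: Pt.
Qed.

(** Chains are modules over [k] only, so a linear map from them into an [A]-module needs its target
    viewed over [k]. The alias carries this second scalar action. *)
Definition restrict (R S : pzRingType) (f : {rmorphism R -> S})
  (V : lmodType S) : Type := V.

Section RestrictionOfScalars.
Variables (R S : pzRingType) (f : {rmorphism R -> S}) (V : lmodType S).

HB.instance Definition _ := GRing.Zmodule.on (restrict f V).

Let scale (c : R) (v : restrict f V) : restrict f V := f c *: (v : V).

Fact restrict_scaleA c d v : scale c (scale d v) = scale (c * d) v.
Proof. by rewrite /scale scalerA -rmorphM. Qed.
Fact restrict_scale1 : left_id 1 scale.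
Proof. by move=> v; rewrite /scale rmorph1 scale1r. Qed.
Fact restrict_scaleDr : right_distributive scale +%R.
Proof. by move=> c u v; exact: scalerDr. Qed.
Fact restrict_scaleDl v : {morph scale^~ v : c d / c + d}.
Proof. by move=> c d; rewrite /scale rmorphD; exact: scalerDl. Qed.

HB.instance Definition _ := GRing.Zmodule_isLmodule.Build R (restrict f V)
  restrict_scaleA restrict_scale1 restrict_scaleDr restrict_scaleDl.

Definition restriction : lmodType R := GRing.Lmodule.clone R (restrict f V) _.

End RestrictionOfScalars.

(** * Universal property of Kähler differentials *)

Section KaehlerDifferentials.
Variables (A B : comPzRingType) (eps : {rmorphism B -> A}).

Local Notation d := (kaehler_d eps).

Lemma kaehler_dD a b : d (a + b) = d a + d b.
Proof.
by rewrite -linearD; apply/qpi_eq/mem_span; apply: Or31; exists a, b.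
Qed.

Lemma kaehler_deps (beta : B) a : d (eps beta * a) = eps beta *: d a.
Proof.
by rewrite -linearZ; apply/qpi_eq/mem_span; apply: Or32; exists beta, a.
Qed.

Lemma kaehler_dM a b : d (a * b) = a *: d b + b *: d a.
Proof.
by rewrite -!linearZ -linearD; apply/qpi_eq/mem_span; apply: Or33; exists a, b.
Qed.

Lemma kaehler_ext (W : lmodType A) (g h : {linear kaehler eps -> W}) :
  (forall a, g (d a) = h (d a)) -> g =1 h.
Proof.
move=> gh; apply: quotmod_ext => v.
exact: (free_module_ext (g := g \o qpi (spanmod (kaehler_rel eps)))
                        (h := h \o qpi (spanmod (kaehler_rel eps)))).
Qed.

Section Lift.
Variables (W : lmodType A) (D : A -> W).
Hypothesis DD : forall a b, D (a + b) = D a + D b.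
Hypothesis Deps : forall (beta : B) a, D (eps beta * a) = eps beta *: D a.
Hypothesis DM : forall a b, D (a * b) = a *: D b + b *: D a.

(** Each of the three kinds of relation is killed by one hypothesis on [D]; this is why a [B]-linear
    derivation factors through the universal one. *)
Fact kaehler_lift_rel v :
  v \in spanmod (kaehler_rel eps) -> free_lift D v = 0.
Proof.
rewrite unfold_in => /asboolP; elim=> [|c x w xP _ IH]; first exact: linear0.
rewrite linearP IH addr0; suff -> : free_lift D x = 0 by rewrite scaler0.
case: xP => -[a [b ->]]; rewrite linearB.
- by rewrite linearD !free_liftE DD subrr.
- by rewrite linearZ_LR !free_liftE Deps subrr.
- by rewrite linearD !linearZ_LR !free_liftE DM subrr.
Qed.

Definition kaehler_lift : {linear kaehler eps -> W} := qlift kaehler_lift_rel.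

Lemma kaehler_liftE a : kaehler_lift (d a) = D a.
Proof. by rewrite /kaehler_lift /kaehler_d qliftE free_liftE. Qed.

End Lift.
End KaehlerDifferentials.

Arguments kaehler_lift : simpl never.

(** * First homology of a symmetric bimodule *)

Section FirstHomology.
Variables (k : fieldType) (A B : comAlgebra k) (eps : triple A B).
Variables (M : bimodule A) (symM : bim_symmetric M).

Local Notation C1 := (chain1 M).
Local Notation H := (H1_module eps symM).
Local Notation T := (tensor (left_module M) (kaehler eps)).
Local Notation d := (kaehler_d eps).

(** Symmetry of [M] makes [d1] vanish, so any 1-chain has a homology class. *)
Definition chain_cycle (x : C1) : kernel (d1 M) :=
  Kernel (introT eqP (d1_symmetric symM x)).

Definition chain_class (x : C1) : H := hclass (d2 eps M) (chain_cycle x).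

Definition H1_gen (m : left_module M) (a : A) : H :=
  chain_class (tens (m : M) (a : vsp A)).

(** The target is [H1 eps M] rather than [H] because linearity here is over [k]; both have the same
    elements. *)
Lemma chain_class_linear : linear (chain_class : C1 -> H1 eps M).
Proof.
move=> c x y; rewrite /chain_class /hclass -linearP; congr (qpi _ _).
exact/val_inj.
Qed.

Lemma chain_classD x y : chain_class (x + y) = chain_class x + chain_class y.
Proof. exact: (linear_additive chain_class_linear). Qed.

Lemma chain_class_boundary u : chain_class (d2 eps M u) = 0.
Proof. by apply/qpi0; rewrite unfold_in; apply/asboolP; exists u. Qed.

Lemma chain_class_surj (h : H) : exists x, h = chain_class x.
Proof.
elim/H1_ind: h => z; exists (ker_val z); congr (qpi _ _); exact/val_inj.
Qed.

Lemma chain_classZ (a : A) x :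
  a *: chain_class x = chain_class (chain1_act M a x).
Proof.
by rewrite H1_moduleZ /chain_class H1_actE; congr (qpi _ _); exact/val_inj.
Qed.

Lemma H1_genZ (a : A) m x : a *: H1_gen m x = H1_gen (a *: m) x.
Proof. by rewrite chain_classZ chain1_actE. Qed.

Lemma H1_genDl m m' x : H1_gen (m + m') x = H1_gen m x + H1_gen m' x.
Proof.
rewrite -chain_classD; congr chain_class.
exact: (linear_additive ((tens_bilinear M (vsp A)).1 x)).
Qed.

Lemma H1_genDr m x y : H1_gen m (x + y) = H1_gen m x + H1_gen m y.
Proof.
rewrite -chain_classD; congr chain_class.
exact: (linear_additive ((tens_bilinear M (vsp A)).2 m)).
Qed.

Lemma H1_gen_rel m a b (alpha : B) :
  H1_gen m (a * eps alpha * b) =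
  (a * eps alpha) *: H1_gen m b + (b * eps alpha) *: H1_gen m a.
Proof.
have := chain_class_boundary
  (tens4 (m : M) (a : vsp A) (b : vsp A) (alpha : vsp B)).
(* [symM] turns the right action into a left one, so that both outer terms become [A]-multiples of
   generators. *)
rewrite d2E /d2_elem symM addrAC chain_classD chain_classD => /eqP.
have -> : chain_class (- tens (m : M) (a * eps alpha * b : vsp A)) =
    - H1_gen m (a * eps alpha * b).
  exact: (linearN (bundle_linear chain_class_linear)).
by rewrite subr_eq0 !H1_genZ => /eqP <-.
Qed.

Lemma H1_genM m a b : H1_gen m (a * b) = a *: H1_gen m b + b *: H1_gen m a.
Proof. by have := H1_gen_rel m a b 1; rewrite rmorph1 !mulr1. Qed.

Lemma H1_gen1 m : H1_gen m 1 = 0.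
Proof.
(* Leibniz for [1 * 1] says that this class equals its own double. *)
apply: (@addrI _ (H1_gen m 1)).
by have := H1_genM m 1 1; rewrite mulr1 scale1r addr0.
Qed.

Lemma H1_gen_eps m (beta : B) a :
  H1_gen m (eps beta * a) = eps beta *: H1_gen m a.
Proof.
by have := H1_gen_rel m 1 a beta; rewrite !mul1r H1_gen1 scaler0 addr0.
Qed.

Lemma H1_ext (W : lmodType A) (g h : {linear H -> W}) :
  (forall m a, g (H1_gen m a) = h (H1_gen m a)) -> g =1 h.
Proof.
(* [g] is [A]-linear and [chain_class] is [k]-linear, so [tensor_ext] does not apply to their
   composite; induction uses additivity alone. *)
move=> gh x; have [c ->] := chain_class_surj x.
elim/tensor_ind: c => [|c c' IH IH'|m a]; last exact: gh.
  have -> : chain_class 0 = 0.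
    exact: (linear0 (bundle_linear chain_class_linear)).
  by rewrite !linear0.
by rewrite chain_classD !linearD IH IH'.
Qed.

Definition H1_of_kaehler (m : left_module M) : {linear kaehler eps -> H} :=
  kaehler_lift (H1_genDr m) (H1_gen_eps m) (H1_genM m).

Lemma H1_of_tensor_bilinear :
  bilinear_map (fun m (w : kaehler eps) => H1_of_kaehler m w).
Proof.
split=> [w c m m'|m]; last exact: linearP.
apply: (kaehler_ext (g := H1_of_kaehler (c *: m + m'))
  (h := bundle_linear (comb_linear c (H1_of_kaehler m) (H1_of_kaehler m')))).
move=> a; rewrite [RHS]/(c *: H1_of_kaehler m (d a) + H1_of_kaehler m' (d a)).
by rewrite !kaehler_liftE H1_genDl H1_genZ.
Qed.

Definition H1_of_tensor : {linear T -> H} := tensor_lift H1_of_tensor_bilinear.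

Lemma H1_of_tensorE m a : H1_of_tensor (tens m (d a)) = H1_gen m a.
Proof. by rewrite /H1_of_tensor tensor_liftE kaehler_liftE. Qed.

(** * The map from homology to the tensor product *)

Local Notation Tk := (restriction (calg_map A) T).

Lemma vspZ (c : k) (x : vsp A) : c *: x = calg_map A c * (x : A).
Proof. by []. Qed.

Lemma lact_calg_map (c : k) (m : M) : c *: m = lact (calg_map A c : vsp A) m.
Proof.
have -> : (calg_map A c : vsp A) = c *: ((1 : A) : vsp A) by exact/esym/mulr1.
by rewrite (linear_scalable ((lact_bilinear M).1 m)) lact1.
Qed.

Lemma tensor_of_chain_bilinear :
  bilinear_map (fun (m : M) (a : vsp A) => tens (m : left_module M) (d a) : Tk).
Proof.
have [t1 t2] := tens_bilinear (left_module M) (kaehler eps).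
split=> [a c m m'|m c a a'].
  by rewrite lact_calg_map; exact: (t1 (d a) (calg_map A c) m m').
(* Scalars of [k] reach [A] through [B], so [B]-linearity of [d] yields [k]-linearity. *)
rewrite vspZ kaehler_dD -[calg_map A c](triple_mapk eps) kaehler_deps.
by rewrite (triple_mapk eps); exact: (t2 m (calg_map A c)).
Qed.

Definition tensor_of_chain : {linear C1 -> Tk} :=
  tensor_lift tensor_of_chain_bilinear.

Lemma tensor_of_chainE (m : M) (a : vsp A) :
  tensor_of_chain (tens m a) = tens (m : left_module M) (d a).
Proof. exact: tensor_liftE. Qed.

Lemma tensor_of_chain_d2 u : tensor_of_chain (d2 eps M u) = 0.
Proof.
apply: (tensor_ext4 (g := tensor_of_chain \o d2 eps M) (h := \0)) => m a b al.
apply: etrans (congr1 tensor_of_chain (d2E eps m a b al)) _.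
rewrite /d2_elem symM linearD linearB !tensor_of_chainE.
have [t1 t2] := tens_bilinear (left_module M) (kaehler eps).
have lactT (c : A) w : tens (lact (c : vsp A) m : left_module M) w =
    c *: tens (m : left_module M) w :> T.
  exact: (linear_scalable (t1 w) c).
(* With [eps al] in front, [B]-linearity takes it out of [d] and Leibniz expands the remaining
   [d (a * b)]; the two resulting terms cancel the outer ones. *)
rewrite !lactT [_ * eps al]mulrC -mulrA kaehler_deps kaehler_dM.
rewrite scalerDr !scalerA (linear_additive (t2 m)) !(linear_scalable (t2 m)).
rewrite [b * _]mulrC opprD addrA subrr sub0r; exact: addNr.
Qed.

Fact tensor_of_cycle_linear :
  linear (fun z : kernel (d1 M) => tensor_of_chain (ker_val z)).
Proof. by move=> c x y; exact: (linearP tensor_of_chain c (ker_val x)). Qed.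

Fact tensor_of_cycle_boundary z : z \in boundaries (d2 eps M) (d1 M) ->
  bundle_linear tensor_of_cycle_linear z = 0.
Proof.
rewrite unfold_in => /asboolP[u uz].
by apply: etrans (tensor_of_chain_d2 u); rewrite uz.
Qed.

Definition tensor_of_H1_fun : {linear H1 eps M -> Tk} :=
  qlift tensor_of_cycle_boundary.

Lemma tensor_of_H1_funE x :
  tensor_of_H1_fun (chain_class x) = tensor_of_chain x.
Proof. exact: qliftE. Qed.

(** This upgrades the descended map from [k]-linear to [A]-linear, since [A] acts on homology
    through the factor [M] of chains. *)
Lemma tensor_of_chainZ (a : A) x :
  tensor_of_chain (chain1_act M a x) = a *: (tensor_of_chain x : T).
Proof.
elim/tensor_ind: x => [|x y IHx IHy|m b].
- rewrite (linear0 (chain1_act M a)) (linear0 tensor_of_chain).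
  exact: esym (@scaler0 A T a).
- rewrite (linearD (chain1_act M a)) !(linearD tensor_of_chain) IHx IHy.
  exact: esym (@scalerDr A T a _ _).
rewrite chain1_actE !tensor_of_chainE.
have [t1 _] := tens_bilinear (left_module M) (kaehler eps).
exact: (linear_scalable (t1 (d b)) a).
Qed.

Fact tensor_of_H1_linear : linear (fun h : H => tensor_of_H1_fun h : T).
Proof.
move=> a g h; have [x ->] := chain_class_surj g.
have [y ->] := chain_class_surj h.
rewrite chain_classZ -chain_classD !tensor_of_H1_funE linearD.
by rewrite tensor_of_chainZ.
Qed.

Definition tensor_of_H1 : {linear H -> T} := bundle_linear tensor_of_H1_linear.

Lemma tensor_of_H1E m a : tensor_of_H1 (H1_gen m a) = tens m (d a).
Proof.
rewrite -[RHS](tensor_of_chainE (m : M) (a : vsp A)).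
exact: (tensor_of_H1_funE (tens (m : M) (a : vsp A))).
Qed.

Lemma H1_isomorphic_tensor : lmod_isomorphic H T.
Proof.
apply: (cancel_lmod_isomorphic (f := tensor_of_H1) (g := H1_of_tensor)).
  apply: (H1_ext (g := H1_of_tensor \o tensor_of_H1) (h := idfun)) => m a.
  by rewrite -[RHS]H1_of_tensorE -tensor_of_H1E.
apply: (tensor_ext (g := tensor_of_H1 \o H1_of_tensor) (h := idfun)) => m w.
have t2 := (tens_bilinear (left_module M) (kaehler eps)).2 m.
(* For fixed [m] both sides are [A]-linear in [w], so it suffices to take [w = d a]. *)
apply: (kaehler_ext (g := tensor_of_H1 \o H1_of_tensor \o bundle_linear t2)
                    (h := bundle_linear t2)) => a.
by apply: etrans (congr1 tensor_of_H1 (H1_of_tensorE m a)) (tensor_of_H1E m a).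
Qed.

End FirstHomology.

(** * Tensoring with the regular module *)

Section RegularTensor.
Variables (k : fieldType) (A : comAlgebra k) (V : lmodType A).

Local Notation A1 := (left_module (regular_bimodule A)).

Lemma scale_bilinear : bilinear_map (fun (a : A1) (v : V) => (a : A) *: v).
Proof.
split=> [v c a b|a c u v].
  by rewrite [LHS]scalerDl; congr (_ + _); exact/esym/scalerA.
by rewrite scalerDr !scalerA mulrC.
Qed.

Definition scale_tensor : {linear tensor A1 V -> V} :=
  tensor_lift scale_bilinear.

Lemma regular_tensor_isomorphic : lmod_isomorphic (tensor A1 V) V.
Proof.
have [t1 t2] := tens_bilinear A1 V.
apply: (cancel_lmod_isomorphic (f := scale_tensor)
                               (g := bundle_linear (t2 (1 : A)))).
  apply: (tensor_ext (g := bundle_linear (t2 (1 : A)) \o scale_tensor)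
                     (h := idfun)) => a v.
  apply: etrans (congr1 _ (tensor_liftE scale_bilinear a v)) _.
  (* The scalar [a] crosses the tensor sign: 1 ⊗ av = a(1 ⊗ v) = (a1) ⊗ v. *)
  apply: etrans (linear_scalable (t2 (1 : A)) (a : A) v) _.
  apply: etrans (esym (linear_scalable (t1 v) (a : A) (1 : A))) _.
  by congr (tens _ v); exact: mulr1.
move=> v; apply: etrans (tensor_liftE scale_bilinear _ v) _; exact: scale1r.
Qed.

End RegularTensor.

Theorem proposition3p2 (k : fieldType) (A B : comAlgebra k) (eps : triple A B)
    (M : bimodule A) (symM : bim_symmetric M) :
  lmod_isomorphic (H1_module eps symM)
    (tensor (left_module M) (kaehler eps))
  /\
  lmod_isomorphic (H1_module eps (regular_symmetric A)) (kaehler eps).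
Proof.
split; first exact: H1_isomorphic_tensor.
(* The case M = A of the first claim, followed by A ⊗_A Ω ≅ Ω. *)
apply: lmod_isomorphic_trans (regular_tensor_isomorphic _).
exact: H1_isomorphic_tensor.
Qed.
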